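(* Let $k$ be a positive integer. A numerical semigroup $\mathcal{S}$ is a $k$-quotient if and only if it is $k$-ray-normalescent.
   Context: Let $\mathbb{N}=\{0,1,2,\dots\}$. A numerical semigroup is a set $\mathcal{S}\subseteq\mathbb{N}$ that contains $0$ and is closed under addition (it is not required that $\gcd(\mathcal{S})=1$). For positive integers $a_1,\dots,a_k$, $\langle a_1,\dots,a_k\rangle=\{a_1x_1+\cdots+a_kx_k : x_i\in\mathbb{N}\}$. For a numerical semigroup $\mathcal{T}$ and a positive integer $d$, the quotient is $\mathcal{T}/d=\{t\in\mathbb{N}: dt\in\mathcal{T}\}$. A numerical semigroup $\mathcal{S}$ is a $k$-quotient if $\mathcal{S}=\langle a_1,\dots,a_k\rangle/d$ for some positive integers $d,a_1,\dots,a_k$. For vectors $\mathbf{v}_1,\dots,\mathbf{v}_\ell\in\mathbb{R}^m$, $\operatorname{cone}(\mathbf{v}_1,\dots,\mathbf{v}_\ell)=\{\lambda_1\mathbf{v}_1+\cdots+\lambda_\ell\mathbf{v}_\ell:\lambda_i\in\mathbb{R}_{\ge 0}\}$. A rational polyhedral cone in $\mathbb{R}^m$ is a pointed (containing no line) set of the form $\operatorname{cone}(\mathbf{v}_1,\dots,\mathbf{v}_\ell)$ with $\mathbf{v}_i\in\mathbb{Z}^m$. Its extreme rays are the vectors of the minimal set $\mathbf{v}_1,\dots,\mathbf{v}_k$ (unique up to positive scaling) that generates the cone. A numerical semigroup $\mathcal{S}$ is $k$-ray-normalescent if $\mathcal{S}=\pi(\mathcal{C}\cap\mathbb{Z}^m)$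 for some $m$, some rational polyhedral cone $\mathcal{C}\subseteq\mathbb{R}^m$ with $k$ extreme rays, and some linear map $\pi:\mathbb{R}^m\to\mathbb{R}$ with integer coefficients.
   Formalization: The semigroup S = {0} is excluded: it is never a k-quotient since the a_i are positive, yet it is k-ray-normalescent (nonnegative orthant of R^k with π = 0), so the claim fails for it as stated. *)

(* Defs.v *)
From mathcomp Require Import all_boot all_order all_algebra.
From mathcomp Require Import boolp classical_sets reals.

Set Implicit Arguments.
Unset Strict Implicit.
Unset Printing Implicit Defensive.

Import Order.TTheory GRing.Theory Num.Theory.

Local Open Scope classical_set_scope.
Local Open Scope ring_scope.

Definition numerical_semigroup (S : set nat) : Prop :=
  S 0%N /\ forall a b : nat, S a -> S b -> S (a + b)%N.

Definition generated (k : nat) (a : 'I_k -> nat) : set nat :=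
  [set n : nat | exists x : 'I_k -> nat, n = (\sum_(i < k) a i * x i)%N].

Definition quotient (T : set nat) (d : nat) : set nat :=
  [set t : nat | T (d * t)%N].

Definition is_k_quotient (k : nat) (S : set nat) : Prop :=
  exists (d : nat) (a : 'I_k -> nat),
    [/\ (0 < d)%N, forall i, (0 < a i)%N & S = quotient (generated a) d].

Section Cones.
Variables (R : realType) (m : nat).
Implicit Types C : set 'rV[R]_m.

(* The cone generated by the subfamily (v i), i in A; the cone of the empty
   subfamily is {0}. *)
Definition subcone (l : nat) (v : 'I_l -> 'rV[R]_m) (A : {set 'I_l}) :
    set 'rV[R]_m :=
  [set x | exists lam : 'I_l -> R,
     (forall i, 0 <= lam i) /\ x = \sum_(i in A) lam i *: v i].

Definition cone (l : nat) (v : 'I_l -> 'rV[R]_m) : set 'rV[R]_m :=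
  [set x | exists lam : 'I_l -> R,
     (forall i, 0 <= lam i) /\ x = \sum_(i < l) lam i *: v i].

Definition pointed_cone C : Prop :=
  ~ exists p u : 'rV[R]_m, u != 0 /\ forall t : R, C (p + t *: u).

Definition integer_points : set 'rV[R]_m :=
  [set x | x \is a mxOver Num.int].

Definition rational_polyhedral_cone C : Prop :=
  pointed_cone C /\
  exists (l : nat) (v : 'I_l -> 'rV[R]_m),
    (forall i, integer_points (v i)) /\ C = cone v.

(* Minimality with respect to inclusion: no proper subfamily generates C. In
   particular the v i are then nonzero and pairwise distinct. *)
Definition extreme_rays C (k : nat) (v : 'I_k -> 'rV[R]_m) : Prop :=
  C = cone v /\ forall A : {set 'I_k}, C = subcone v A -> A = [set: 'I_k]%SET.

(* The coefficients of pi are its values on the standard basis. *)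
Definition integer_coefficients (pi : {scalar 'rV[R]_m}) : Prop :=
  forall j : 'I_m, pi (delta_mx 0 j) \is a Num.int.

End Cones.

(* S is viewed as a subset of R, so the equation also forces pi to take
   natural number values on the lattice points of C. *)
Definition k_ray_normalescent (R : realType) (k : nat) (S : set nat) : Prop :=
  exists (m : nat) (C : set 'rV[R]_m) (pi : {scalar 'rV[R]_m}),
    [/\ rational_polyhedral_cone C,
        exists v : 'I_k -> 'rV[R]_m, extreme_rays C v,
        integer_coefficients pi &
        (fun n : nat => n%:R : R) @` S = pi @` (C `&` @integer_points R m)].

(* Main.v *)
Require Import Defs.
From HB Require Import structures.
From mathcomp Require Import all_boot all_order all_algebra.
From mathcomp Require Import boolp classical_sets reals.
From mathcomp Require Import zify ring.

(* If dS is the set of multiples of d in <a_1, ..., a_k>, then S is the image of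
   the lattice points of the cone {(x, t) : x >= 0, a . x = d t} under (x, t) |-> t.

   Conversely, let C be generated by integer vectors w_1, ..., w_k; one may assume
   p_i = pi(w_i) > 0 after dividing out the saturation of the span of the w_i with
   p_i = 0.  By Caratheodory there is D with S = {p . z / D : z in L, z >= 0}, for a
   lattice L in Z^k that contains D Z^k; let M be the group of integral forms that
   take multiples of D as values on L, so that p is in M.  Nothing changes if the
   orthant is enlarged slightly to {z : f_i(z) >= 0 for all i}: values below a bound
   come from a compact region, and every value of p on L / D above it is already
   in S.  The f_i can be chosen in M so that f_1, ..., f_k and p generate M.
   Then d p = a_1 f_1 + ... + a_k f_k with a_i > 0, and duality identifies the points
   of L in the enlarged cone with the x in N^k such that d divides a . x. *)

Set Implicit Arguments.
Unset Strict Implicit.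
Unset Printing Implicit Defensive.

Import Order.TTheory GRing.Theory Num.Theory.

Local Open Scope ring_scope.

(** * Lattices of integral linear forms *)

Definition dot (k : nat) (f : 'rV[int]_k) (z : 'cV[int]_k) : int :=
  (f *m z) 0 0.

Section Dot.
Variable k : nat.
Implicit Types (f g : 'rV[int]_k) (z y : 'cV[int]_k).

Lemma dotE f z : dot f z = \sum_j f 0 j * z j 0.
Proof. by rewrite /dot mxE. Qed.

Lemma dotDl f g z : dot (f + g) z = dot f z + dot g z.
Proof. by rewrite /dot mulmxDl !mxE. Qed.

Lemma dotZl c f z : dot (c *: f) z = c * dot f z.
Proof. by rewrite /dot -scalemxAl !mxE. Qed.

Lemma dotDr f z y : dot f (z + y) = dot f z + dot f y.
Proof. by rewrite /dot mulmxDr !mxE. Qed.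

Lemma dotNr f z : dot f (- z) = - dot f z.
Proof. by rewrite /dot mulmxN !mxE. Qed.

Lemma dotZr c f z : dot f (c *: z) = c * dot f z.
Proof. by rewrite /dot -scalemxAr !mxE. Qed.

Lemma dot_delta j z : dot (delta_mx 0 j) z = z j 0.
Proof. by rewrite /dot -rowE mxE. Qed.

Lemma dotMl m (u : 'rV[int]_m) (F : 'M[int]_(m, k)) z :
  dot (u *m F) z = dot u (F *m z).
Proof. by rewrite /dot mulmxA. Qed.

Lemma dot_row m (F : 'M[int]_(m, k)) i z : dot (row i F) z = (F *m z) i 0.
Proof. by rewrite /dot -row_mul mxE. Qed.

End Dot.

Section Subgroup.
Variables (V : lmodType int) (M : V -> Prop).
Hypotheses (M0 : M 0) (MB : forall f g, M f -> M g -> M (f - g)).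

Lemma subgroupD f g : M f -> M g -> M (f + g).
Proof.
by move=> Mf Mg; rewrite -[g]opprK; apply: MB => //; rewrite -sub0r; exact: MB.
Qed.

Lemma subgroupZ c f : M f -> M (c *: f).
Proof.
move=> Mf; have MN (j : nat) : M (j%:Z *: f).
  elim: j => [|j IH]; first by rewrite scale0r.
  by rewrite intS scalerDl scale1r; exact: subgroupD.
case: c => j; first exact: MN.
by rewrite NegzE scaleNr -sub0r; exact: MB.
Qed.

End Subgroup.

(** * Hermite bases of groups of integral forms *)

Section Hermite.
Variables (n : nat) (M : 'rV[int]_n.+1 -> Prop) (D : int).
Hypothesis MB : forall f g, M f -> M g -> M (f - g).
Hypothesis MD : forall e, M (D *: e).
Hypothesis D_gt0 : 0 < D.

Let M0 : M 0. Proof. by have := MD 0; rewrite scaler0. Qed.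

(** A row of a Hermite normal form, with [i] as leading index. Its entries are kept nonnegative so
    that the facets built from it are nonnegative on the orthant. *)
Definition hermite_vector (i : 'I_n.+1) (b : 'rV[int]_n.+1) :=
  [/\ M b, forall j, 0 <= b 0 j, forall j : 'I_n.+1, (i < j)%N -> b 0 j = 0
    & forall f, M f -> (forall j : 'I_n.+1, (i < j)%N -> f 0 j = 0) ->
      exists q, f 0 i = q * b 0 i].

(** Among the forms of [M] vanishing beyond [i], take one with least positive [i]-th entry;
    [D *: delta_mx 0 i] shows that one exists, and division with remainder gives divisibility. *)
Lemma hermite_basis :
  exists b : 'I_n.+1 -> 'rV[int]_n.+1, forall i, hermite_vector i (b i).
Proof.
suff /choice[b hb] : forall i, exists b, hermite_vector i b by exists b.
move=> i.
pose P (a : nat) := `[< (0 < a)%N /\ exists f, [/\ M f,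
  forall j : 'I_n.+1, (i < j)%N -> f 0 j = 0 & f 0 i = a%:Z] >].
have exP : exists a, P a.
  exists `|D|%N; apply/asboolP; split; first by rewrite absz_gt0 gt_eqF.
  exists (D *: delta_mx 0 i); split; first exact: MD.
    by move=> j ij; rewrite !mxE eqxx andTb (gtn_eqF ij : (j == i) = false) mulr0.
  by rewrite !mxE !eqxx mulr1 gez0_abs // ltW.
case: (ex_minnP exP) => a /asboolP[a_gt0 [f [Mf f0 fi]]] amin.
(* Adding [D *: e] makes the entries before [i] nonnegative and leaves the others unchanged. *)
pose e : 'rV[int]_n.+1 := \row_j (if (j < i)%N then `|f 0 j| else 0).
exists (f + D *: e); split.
- by apply: (subgroupD M0 MB).
- move=> j; rewrite !mxE; case: ltngtP => [ji|ij|/val_inj->].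
  + have fD : `|f 0 j| <= D * `|f 0 j| by rewrite ler_peMl.
    have h : 0 <= f 0 j + `|f 0 j| by rewrite -lerBlDl sub0r -normrN ler_norm.
    by apply: le_trans h _; rewrite lerD2l.
  + by rewrite f0 // mulr0.
  + by rewrite fi mulr0 addr0.
- by move=> j ij; rewrite !mxE ltnNge (ltnW ij) /= f0 // mulr0.
move=> g Mg g0; rewrite !mxE ltnn mulr0 addr0 fi.
set gi := g 0 i.
exists (gi %/ a%:Z)%Z.
have az : a%:Z != 0 by lia.
apply/eqP; rewrite {1}(divz_eq gi a%:Z) -subr_eq0 addrAC subrr add0r.
apply/negPn/negP => r0.
have r_ge0 := modz_ge0 gi az.
have r_lt := ltz_mod gi az.
have := amin `|(gi %% a%:Z)%Z|%N.
suff -> : P `|(gi %% a%:Z)%Z|%N by move=> /(_ isT); lia.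
apply/asboolP; split; first by rewrite absz_gt0.
exists (g - (gi %/ a%:Z)%Z *: f); split.
- by apply: MB => //; exact: (subgroupZ M0 MB).
- by move=> j ij; rewrite !mxE g0 // f0 // mulr0 subr0.
- rewrite !mxE fi gez0_abs // {1}(divz_eq gi a%:Z).
Qed.

(* f_i = c_i D e_i + b_{i+1} expresses b_{i+1} through b_0, ..., b_i. *)
Lemma hermite_chain (H : 'rV[int]_n.+1 -> Prop) (b : 'I_n.+1 -> 'rV[int]_n.+1)
    (c : 'I_n.+1 -> int) :
  (forall i, hermite_vector i (b i)) ->
  H 0 -> (forall f g, H f -> H g -> H (f - g)) -> H (b ord0) ->
  (forall i : 'I_n.+1, (i < n)%N ->
     H ((c i * D) *: delta_mx 0 i + b (ordS i))) ->
  forall f, M f -> H f.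
Proof.
move=> hb H0 Hsub Hb0 Hf.
have main (i : nat) : (i <= n.+1)%N -> forall f, M f ->
    (forall j : 'I_n.+1, (i <= j)%N -> f 0 j = 0) -> H f.
  elim: i => [_|i IH iLn] f Mf f0.
    suff -> : f = 0 by [].
    by apply/rowP => j; rewrite f0 // mxE.
  have Hb : H (b (Ordinal iLn)).
    case: i IH iLn {f0} => [|i] IH iLn.
      by rewrite (_ : Ordinal _ = ord0) //; exact: val_inj.
    pose i' : 'I_n.+1 := Ordinal (ltnW iLn).
    (* [D *: delta_mx 0 i'] lies in [M] and vanishes beyond [i'], so it is in [H] by induction. *)
    have -> : b (Ordinal iLn) =
        ((c i' * D) *: delta_mx 0 i' + b (ordS i')) - c i' *: (D *: delta_mx 0 i').
      rewrite scalerA addrAC subrr add0r; congr b; apply: val_inj => /=.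
      by rewrite modn_small.
    apply: (Hsub); first exact: Hf.
    apply: (subgroupZ H0 Hsub); apply: IH => //; first exact: ltnW.
    move=> j ij; rewrite !mxE /= -val_eqE /= (gtn_eqF ij) mulr0 //.
  case: (hb (Ordinal iLn)) => Mb _ b0 /(_ f Mf f0)[q fq].
  rewrite -(subrK (q *: b (Ordinal iLn)) f).
  apply: (subgroupD H0 Hsub); last exact: (subgroupZ H0 Hsub).
  apply: (IH (ltnW iLn)).
    by apply: MB => //; exact: (subgroupZ M0 MB).
  move=> j; rewrite leq_eqVlt => /orP[/eqP ij|ij].
    rewrite !mxE (_ : j = Ordinal iLn) ?fq ?subrr //.
    exact: val_inj.
  by rewrite !mxE f0 // b0 // mulr0 subr0.
move=> f Mf; apply: (main n.+1) => // j.
by rewrite leqNgt ltn_ord.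
Qed.

End Hermite.

(** * Small perturbations of the orthant *)

(** Let [A] be the largest [|x i 0|], attained at [j]. The perturbations contribute at most [B * A],
    so no coordinate is far below zero; hence [x j 0 = A], and its term in [dot p x] dominates the
    others because [K0] exceeds [2 * P * B]. *)
Lemma coercive k (p : 'rV[int]_k) (g : 'I_k -> 'rV[int]_k) (K : 'I_k -> int)
    (beta K0 : int) (x : 'cV[int]_k) :
  (forall j, 0 < p 0 j) -> 0 <= beta ->
  (forall i j, `|g i 0 j| <= beta) -> (forall i, K0 <= K i) ->
  2 * (\sum_j p 0 j) * (k%:Z * beta) + k%:Z * beta < K0 ->
  (forall i, 0 <= K i * x i 0 + dot (g i) x) ->
  (forall i, `|x i 0| <= 2 * dot p x) /\
  (forall i, - (2 * dot p x * (k%:Z * beta)) <= K0 * x i 0).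
Proof.
move=> p_gt0 beta0 hg hK hK0 hx.
case: k p g K x p_gt0 hg hK hK0 hx => [|k] p g K x p_gt0 hg hK hK0 hx.
  by split; case.
set B := k.+1%:Z * beta in hK0 *.
have B0 : 0 <= B by rewrite mulr_ge0.
set P := \sum_j p 0 j in hK0 *.
have P0 : 0 <= P by apply: sumr_ge0 => j _; exact: ltW.
have K00 : 0 <= K0 by nia.
pose j := [arg max_(i > ord0) `|x i 0|]%O.
have jmax i : `|x i 0| <= `|x j 0|.
  by rewrite /j; case: arg_maxP => // j' _ /(_ i isT).
set A := `|x j 0| in jmax.
have A0 : 0 <= A by exact: normr_ge0.
have dg i : dot (g i) x <= B * A.
  apply: (@le_trans _ _ (\sum_(l < k.+1) beta * A)).
    rewrite dotE; apply: ler_sum => l _.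
    by apply: le_trans (ler_norm _) _; rewrite normrM ler_pM.
  by rewrite sumr_const card_ord -mulr_natl natz mulrA.
have xlow i : - (B * A) <= K0 * x i 0.
  have [x0|x0] := leP 0 (x i 0).
    by apply: (@le_trans _ _ 0); rewrite ?oppr_le0 ?mulr_ge0.
  have := hx i; have := dg i; have := hK i; nia.
have xj : x j 0 = A.
  have [x0|x0] := leP 0 (x j 0); first by rewrite /A ger0_norm.
  have := xlow j; have hA : A = - x j 0 by rewrite /A ltr0_norm.
  nia.
have key : K0 * A - P * (B * A) <= K0 * dot p x.
  rewrite dotE mulr_sumr (bigD1 j) //=.
  have -> : K0 * A - P * (B * A) = (K0 * A - p 0 j * (B * A)) +
      \sum_(i | i != j) - (p 0 i * (B * A)).
    by rewrite /P (bigD1 j) //= sumrN -mulr_suml; ring.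
  apply: lerD.
    rewrite xj; have := p_gt0 j; have : 0 <= B * A by rewrite mulr_ge0.
    nia.
  apply: ler_sum => i _; have := xlow i; have := p_gt0 i; nia.
have hA : A <= 2 * dot p x.
  have PB : 0 <= P * B by rewrite mulr_ge0.
  nia.
split=> i; first exact: le_trans (jmax i) hA.
by apply: le_trans (xlow i); rewrite lerN2 mulrC ler_wpM2r.
Qed.

(** On a nonzero kernel vector of [F] and on its opposite [p] would be positive, so [F] is
    invertible, and [Y] is its adjugate up to sign. Thus [d *: p] has the positive coefficients
    [p *m Y] over the rows of [F]. *)
Lemma dual_basis k (F : 'M[int]_k) (p : 'rV[int]_k) :
  (forall x, (forall i, 0 <= (F *m x) i 0) -> x != 0 -> 0 < dot p x) ->
  exists (d : int) (Y : 'M[int]_k),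
    [/\ 0 < d, F *m Y = d%:M, Y *m F = d%:M & forall i, 0 < (p *m Y) 0 i].
Proof.
move=> Fpos.
have detF : \det F != 0.
  rewrite -det_tr; apply/negP => /det0P[v v0 vF].
  have Fv : F *m v^T = 0 by apply: trmx_inj; rewrite trmx_mul trmxK vF trmx0.
  have v0' : v^T != 0 by rewrite -trmx0 (inj_eq trmx_inj).
  have := Fpos v^T; rewrite Fv => /(_ (fun i => _)) H.
  have := Fpos (- v^T); rewrite mulmxN Fv oppr0 oppr_eq0 dotNr => H'.
  have h1 : 0 < dot p v^T by apply: H => // i; rewrite mxE.
  have : 0 < - dot p v^T by apply: H' => // i; rewrite mxE.
  by rewrite oppr_gt0 ltNge (ltW h1).
pose s := Num.sg (\det F); pose Y := s *: \adj F.
have d_gt0 : 0 < `|\det F| by rewrite normr_gt0.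
have FY : F *m Y = `|\det F|%:M.
  by rewrite -scalemxAr mul_mx_adj scale_scalar_mx -normrEsg.
have YF : Y *m F = `|\det F|%:M.
  by rewrite -scalemxAl mul_adj_mx scale_scalar_mx -normrEsg.
exists `|\det F|, Y; split=> // i.
have -> : (p *m Y) 0 i = dot p (col i Y) by rewrite /dot colE mulmxA -colE [RHS]mxE.
have FYi : F *m col i Y = col i `|\det F|%:M by rewrite !colE mulmxA FY.
apply: Fpos.
  by move=> j; rewrite FYi !mxE; case: (j == i).
apply/eqP => Yi0; move: FYi; rewrite Yi0 mulmx0 => /colP/(_ i).
by rewrite !mxE eqxx mulr1n => /esym/eqP; rewrite normr_eq0 (negPf detF).
Qed.

(** Reduce all coordinates but the first modulo [D * p 0 0] and compensate in the first, which
    preserves [dot p]. The reduced ones contribute at most the given bound, so the first becomes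
    nonnegative. *)
Lemma nonneg_shift k (p : 'rV[int]_k.+1) (D : int) (x : 'cV[int]_k.+1) :
  (forall j, 0 < p 0 j) -> 0 < D ->
  D * (p 0 0 * \sum_j p 0 j) <= dot p x ->
  exists e, dot p e = 0 /\ forall i, 0 <= (x + D *: e) i 0.
Proof.
move=> p_gt0 D_gt0 hx.
have Dp : 0 < D * p 0 0 by rewrite mulr_gt0.
have Dp0 : D * p 0 0 != 0 by rewrite gt_eqF.
pose q i := (x i 0%R %/ (D * p 0%R 0%R))%Z.
pose e : 'cV[int]_k.+1 := \col_i (if i == 0 then \sum_(j | j != 0) p 0 j * q j
                                  else - (p 0 0 * q i)).
have pe : dot p e = 0.
  rewrite dotE (bigD1 0) //= mxE eqxx mulr_sumr -big_split /=.
  by apply: big1 => j j0; rewrite mxE (negPf j0); ring.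
have low i : i != 0 -> 0 <= (x + D *: e) i 0 < D * p 0 0.
  move=> i0; rewrite !mxE (negPf i0).
  suff -> : x i 0 + D * - (p 0 0 * q i) = (x i 0%R %% (D * p 0%R 0%R))%Z.
    by rewrite modz_ge0 // ltz_pmod.
  by rewrite {1}(divz_eq (x i 0) (D * p 0 0)) -/(q i); ring.
exists e; split=> // i.
have [->|/low/andP[]//] := eqVneq i 0.
rewrite -(pmulr_rge0 _ (p_gt0 0)).
have : dot p (x + D *: e) = dot p x by rewrite dotDr dotZr pe mulr0 addr0.
rewrite [X in X = _]dotE (bigD1 0) //= => /esym/eqP; rewrite -subr_eq => /eqP <-.
have hle : \sum_(j | j != 0) p 0 j * (x + D *: e) j 0 <=
    D * (p 0 0 * \sum_j p 0 j).
  rewrite [\sum_j _](bigD1 0) //= mulrDr mulrDr !mulr_sumr.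
  apply: (@le_trans _ _ (\sum_(j | j != 0) D * (p 0 0 * p 0 j))).
    apply: ler_sum => j /low/andP[_ h].
    by rewrite mulrA [leRHS]mulrC ler_wpM2l // ltW.
  by rewrite lerDr !mulr_ge0 // ltW.
rewrite subr_ge0; exact: le_trans hle hx.
Qed.

Lemma near_diagE k (K : 'I_k -> int) (g : 'I_k -> 'rV[int]_k) (x : 'cV[int]_k) i :
  ((\matrix_i (K i *: delta_mx 0 i + g i)) *m x) i 0 = K i * x i 0 + dot (g i) x.
Proof. by rewrite -dot_row rowK dotDl dotZl dot_delta. Qed.

Lemma coercive_pos k (p : 'rV[int]_k) (g : 'I_k -> 'rV[int]_k) (K : 'I_k -> int)
    (beta K0 : int) (x : 'cV[int]_k) :
  (forall j, 0 < p 0 j) -> 0 <= beta ->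
  (forall i j, `|g i 0 j| <= beta) -> (forall i, K0 <= K i) ->
  2 * (\sum_j p 0 j) * (k%:Z * beta) + k%:Z * beta < K0 ->
  (forall i, 0 <= ((\matrix_i (K i *: delta_mx 0 i + g i)) *m x) i 0) ->
  x != 0 -> 0 < dot p x.
Proof.
move=> p_gt0 beta0 hg hK hK0 hx x0.
have [|xle _] := @coercive k p g K beta K0 x p_gt0 beta0 hg hK hK0.
  by move=> i; rewrite -near_diagE.
rewrite ltNge; apply: contra x0 => px; apply/eqP/colP => i; rewrite mxE.
apply/eqP; rewrite -normr_eq0 eq_le normr_ge0 andbT.
by apply: le_trans (xle i) _; rewrite pmulr_rle0.
Qed.

(** * Lattice points of a simplicial cone as a quotient *)

Section DualLattice.
Variables (n : nat) (M : 'rV[int]_n.+1 -> Prop) (D : int) (p : 'rV[int]_n.+1).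
Hypothesis MB : forall f g, M f -> M g -> M (f - g).
Hypothesis MD : forall e, M (D *: e).
Hypothesis D_gt0 : 0 < D.
Hypothesis Mp : M p.
Hypothesis p_gt0 : forall j, 0 < p 0 j.

Let M0 : M 0. Proof. by have := MD 0; rewrite scaler0. Qed.

(* The rows f_i = N D e_i + b_{i+1} (i < n), for a Hermite basis b and N large,
   generate M modulo b_0.  Modulo them p = u b_0 with u != 0, and D e_n = w b_0, so
   the last row |u| N D e_n + b_0 is congruent to b_0 up to a multiple of p. *)
Lemma perturbed_facets (C : int) : exists (F : 'M[int]_n.+1) (d : int)
    (Y : 'M[int]_n.+1),
  [/\ (forall i, M (row i F)) /\ (forall i j, 0 <= F i j),
      [/\ 0 < d, F *m Y = d%:M, Y *m F = d%:M & forall i, 0 < (p *m Y) 0 i],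
      forall f, M f -> exists m u, f = m *m F + u *: p
    & forall x, (forall i, 0 <= (F *m x) i 0) -> dot p x <= C ->
        forall i, 0 <= x i 0].
Proof.
have [b hb] := hermite_basis MB MD D_gt0.
have b_ge0 i j : 0 <= b i 0 j by case: (hb i).
pose beta := \sum_i \sum_j b i 0 j.
have bbeta i j : `|b i 0 j| <= beta.
  rewrite ger0_norm // /beta (bigD1 i) //= (bigD1 j) //= -addrA lerDl addr_ge0 //.
    by apply: sumr_ge0.
  by apply: sumr_ge0 => ? _; apply: sumr_ge0.
have beta0 : 0 <= beta by apply: le_trans (bbeta 0 0); exact: normr_ge0.
set P := \sum_j p 0 j.
pose B := n.+1%:Z * beta.
have B0 : 0 <= B by rewrite mulr_ge0.
have P0 : 0 <= P by apply: sumr_ge0 => j _; exact: ltW.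
(* The first two summands make [coercive] applicable; the third turns its lower bound into
   [- N < N * x i 0] when [dot p x <= C], so that the integer [x i 0] is nonnegative. *)
pose N := 2 * P * B + B + 2 * `|C| * B + 1.
have CB : 0 <= 2 * `|C| * B by rewrite !mulr_ge0.
have PB : 0 <= 2 * P * B by rewrite !mulr_ge0.
have hN : 2 * P * B + B < N by rewrite /N; lia.
have hNC : 2 * `|C| * B < N by rewrite /N; lia.
have N_gt0 : 0 < N by apply: le_lt_trans hN; rewrite addr_ge0.
pose f0 i := (N * D) *: delta_mx 0 i + b (ordS i).
pose H1 f := exists u (m : 'I_n.+1 -> int),
  f = u *: b 0 + \sum_(i < n.+1 | (i < n)%N) m i *: f0 i.
have H1M f : M f -> H1 f.
  apply: (hermite_chain MB MD hb (c := fun=> N)).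
  - exists 0, (fun=> 0); rewrite scale0r big1 ?addr0 // => i _.
    by rewrite scale0r.
  - move=> f1 f2 [u1 [m1 ->]] [u2 [m2 ->]]; exists (u1 - u2), (fun i => m1 i - m2 i).
    rewrite opprD addrACA -scalerBl -sumrB; congr (_ + _).
    by apply: eq_bigr => i _; rewrite scalerBl.
  - exists 1, (fun=> 0); rewrite scale1r big1 ?addr0 // => i _.
    by rewrite scale0r.
  - move=> i iln; exists 0, (fun j => (j == i)%:Z); rewrite scale0r add0r.
    rewrite (bigD1 i) //= eqxx scale1r big1 ?addr0 // => j /andP[_ /negPf->].
    by rewrite scale0r.
have [u [m pE]] := H1M p Mp.
have [w [w' DE]] := H1M _ (MD (delta_mx 0 ord_max)).
(* Were [u] zero, [p] would be a combination of the [f0 i] with [i < n]. Complete these by a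
   multiple of the last coordinate form: they all vanish on the last dual vector, where [p] is
   positive by coercivity. *)
have u_neq0 : u != 0.
  apply/eqP => u0.
  pose g (i : 'I_n.+1) := if (i < n)%N then b (ordS i) else 0.
  pose F := \matrix_i ((N * D) *: delta_mx 0 i + g i).
  have [|d [Y [d_gt0 FY _ pY]]] := @dual_basis _ F p.
    move=> x Fx x0; apply: (coercive_pos p_gt0 beta0 _ _ hN Fx x0).
      by move=> i j; rewrite /g; case: ifP => // _; rewrite mxE normr0.
    by move=> i; rewrite ler_pMr //; lia.
  have := pY ord_max.
  have -> : (p *m Y) 0 ord_max = dot p (col ord_max Y).
    by rewrite /dot colE mulmxA -colE [RHS]mxE.
  suff -> : dot p (col ord_max Y) = 0 by rewrite ltxx.
  rewrite pE u0 scale0r add0r /dot mulmx_suml summxE; apply: big1 => i iln.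
  have -> : f0 i = row i F by rewrite rowK /g iln.
  rewrite -scalemxAl mxE -/(dot _ _) dot_row colE mulmxA FY mul_scalar_mx !mxE.
  rewrite (_ : i == ord_max = false) ?mulr0 //.
  by apply/negbTE; rewrite -val_eqE /= ltn_eqF.
pose c (i : 'I_n.+1) := if (i < n)%N then N else `|u| * N.
have hc i : N <= c i.
  by rewrite /c; case: ifP => // _; rewrite ler_peMl; [|exact: ltW|lia].
have hK i : N <= c i * D.
  apply: le_trans (hc i) _; rewrite ler_peMr -?gtz0_ge1 //.
  exact: le_trans (ltW N_gt0) (hc i).
(* [ordS] is cyclic, so the last row is perturbed by [b 0]. *)
pose g i := b (ordS i).
pose F := \matrix_i ((c i * D) *: delta_mx 0 i + g i).
have hg i j : `|g i 0 j| <= beta by exact: bbeta.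
have Fpos x := @coercive_pos _ p g _ beta N x p_gt0 beta0 hg hK hN.
have [d [Y dY]] := dual_basis Fpos.
exists F, d, Y; split=> //.
- split=> [i|i j]; last first.
    rewrite mxE mxE addr_ge0 //; last by rewrite /g.
    by rewrite !mxE !mulr_ge0 // ltW //; apply: lt_le_trans N_gt0 (hc i).
  rewrite rowK -scalerA; apply: (subgroupD M0 MB).
    exact: (subgroupZ M0 MB).
  by case: (hb (ordS i)).
- pose H2 f := exists (m : 'rV_n.+1) u, f = m *m F + u *: p.
  have H20 : H2 0 by exists 0, 0; rewrite mul0mx scale0r addr0.
  have H2B f1 f2 : H2 f1 -> H2 f2 -> H2 (f1 - f2).
    move=> [m1 [u1 ->]] [m2 [u2 ->]]; exists (m1 - m2), (u1 - u2).
    by rewrite mulmxBl scalerBl opprD addrACA.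
  have H2D := subgroupD H20 H2B.
  have H2Z := subgroupZ H20 H2B.
  have H2F i : H2 (row i F) by exists (delta_mx 0 i), 0; rewrite -rowE scale0r addr0.
  have H2p : H2 p by exists 0, 1; rewrite mul0mx scale1r add0r.
  have H2s (m' : 'I_n.+1 -> int) : H2 (\sum_(i < n.+1 | (i < n)%N) m' i *: f0 i).
    apply: (big_ind H2) => // i iln; apply: H2Z.
    by have := H2F i; rewrite rowK /c iln.
  apply: (hermite_chain MB MD hb (c := c)) => //; last first.
    by move=> i _; have := H2F i; rewrite rowK.
  have bu : u *: b 0 = p - \sum_(i < n.+1 | (i < n)%N) m i *: f0 i.
    by rewrite {1}pE addrK.
  (* All three terms lie in [H2], and the expression equals [b 0]. *)
  have : H2 (row ord_max F - (Num.sg u * N * w) *: (u *: b 0) -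
      (`|u| * N) *: (\sum_(i < n.+1 | (i < n)%N) w' i *: f0 i)).
    by rewrite bu; apply: (H2B); [apply: (H2B) => //; exact/H2Z/H2B|exact: H2Z].
  have -> : row ord_max F = (`|u| * N * w) *: b 0 +
      (`|u| * N) *: (\sum_(i < n.+1 | (i < n)%N) w' i *: f0 i) + b ord0.
    rewrite rowK /c /= ltnn -scalerA DE scalerDr scalerA.
    by congr (_ + b _); apply: val_inj => /=; exact: modnn.
  have -> : (Num.sg u * N * w) *: (u *: b 0) = (`|u| * N * w) *: b 0.
    by rewrite scalerA normrEsg; congr (_ *: _); ring.
  by rewrite [_ + b ord0]addrC addrA addrAC addrK addrK.
move=> x Fx pxC.
have [||_ xlow] := @coercive _ p g (fun i => c i * D) beta N x p_gt0 beta0 hg hK.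
- exact: hN.
- by move=> i; have := Fx i; rewrite near_diagE.
move=> i; have := xlow i; rewrite -/B => xi.
have : - N < N * x i 0.
  apply: lt_le_trans xi; rewrite ltrN2; apply: le_lt_trans hNC.
  by rewrite ler_wpM2r // ler_wpM2l //; apply: le_trans pxC (ler_norm C).
rewrite -mulrN1 ltr_pM2l //; lia.
Qed.

(** A lattice point [z] corresponds to [x = F z / D], and [d *: p = (p *m Y) *m F] turns the value
    of [p] at [z] into [a . x] with [a = p *m Y]. Conversely [x] yields a lattice point of the
    enlarged cone, still to be brought into the orthant. *)
Theorem dual_lattice_quotient : exists (d : nat) (a : 'I_n.+1 -> nat),
  [/\ (0 < d)%N, forall i, (0 < a i)%N & forall t : nat,
    (exists z : 'cV[int]_n.+1, [/\ forall i, 0 <= z i 0,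
        forall f, M f -> (D %| dot f z)%Z & dot p z = D * t%:Z]) <->
    generated a (d * t)%N].
Proof.
have [F [d [Y [[MF F_ge0] [d_gt0 FY YF pY] MFp Fpos]]]] :=
  perturbed_facets (D * (p 0 0 * \sum_j p 0 j)).
pose a i := `|(p *m Y) 0%R i|%N.
have aE i : (a i)%:Z = (p *m Y) 0 i by rewrite gez0_abs // ltW.
have dE : `|d|%N%:Z = d by rewrite gez0_abs // ltW.
have genE (t : nat) (x : 'I_n.+1 -> nat) :
    (`|d| * t = \sum_(i < n.+1) a i * x i)%N <->
    dot (p *m Y) (\col_i (x i)%:Z) = d * t%:Z.
  have -> : dot (p *m Y) (\col_i (x i)%:Z) = (\sum_(i < n.+1) a i * x i)%N%:Z.
    rewrite dotE -[RHS]natz natr_sum; apply: eq_bigr => i _.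
    by rewrite mxE -aE natz PoszM.
  rewrite -{2}dE -PoszM; split=> [->//|[]//].
exists `|d|%N, a; split.
- by rewrite absz_gt0 gt_eqF.
- by move=> i; rewrite absz_gt0 gt_eqF.
move=> t; split.
  move=> [z [z_ge0 Mz pz]].
  have Fz_ge0 i : 0 <= (F *m z) i 0.
    by rewrite mxE; apply: sumr_ge0 => j _; rewrite mulr_ge0.
  have DFz i : (D %| (F *m z) i 0%R)%Z by rewrite -dot_row; exact: Mz.
  exists (fun i => `|((F *m z) i 0%R %/ D)%Z|%N); apply/genE.
  have -> : (\col_i `|((F *m z) i 0%R %/ D)%Z|%N%:Z) =
      \col_i ((F *m z) i 0%R %/ D)%Z.
    by apply/colP => i; rewrite [LHS]mxE [RHS]mxE gez0_abs // divz_ge0.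
  apply: (mulfI (lt0r_neq0 D_gt0)); rewrite -dotZr.
  have -> : D *: (\col_i ((F *m z) i 0%R %/ D)%Z) = F *m z.
    by apply/colP => i; rewrite [LHS]mxE [X in _ * X]mxE mulrC divzK.
  by rewrite -dotMl -mulmxA YF mul_mx_scalar dotZl pz mulrCA.
move=> [x /genE xt].
pose xc : 'cV[int]_n.+1 := \col_i (x i)%:Z.
pose y := D *: (Y *m xc).
have Fy : F *m y = (d * D) *: xc.
  by rewrite -scalemxAr mulmxA FY mul_scalar_mx scalerA mulrC.
have py : dot p y = d * D * t%:Z.
  by rewrite dotZr -dotMl xt; ring.
(* The rows of [F] and [p], which generate [M], take multiples of [d * D] at [y]. *)
have My f : M f -> (d * D %| dot f y)%Z.
  move=> /MFp[m [u ->]].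
  rewrite dotDl dotMl Fy dotZr dotZl py.
  by apply: rpredD; [|apply: dvdz_mull]; exact: dvdz_mulr.
have d0 := lt0r_neq0 d_gt0; have D0 := lt0r_neq0 D_gt0.
pose x0 : 'cV[int]_n.+1 := \col_i (y i 0%R %/ d)%Z.
have yE : y = d *: x0.
  apply/colP => i; rewrite [RHS]mxE [X in _ * X]mxE mulrC divzK //.
  have := My _ (MD (delta_mx 0 i)).
  by rewrite dotZl dot_delta [d * D]mulrC (dvdz_mul2l D0).
have Mx0 f : M f -> (D %| dot f x0)%Z.
  by move=> /My; rewrite yE dotZr (dvdz_mul2l d0).
have px0 : dot p x0 = D * t%:Z.
  by apply: (mulfI d0); rewrite -dotZr -yE py mulrA.
(* A large value is attained in the orthant after a shift along the kernel of [p]; for a small one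
   [x0] is already in the orthant. *)
have [ht|ht] := leP (D * (p 0 0 * \sum_j p 0 j)) (dot p x0).
  have [e [pe ge0]] := nonneg_shift p_gt0 D_gt0 ht.
  exists (x0 + D *: e); split=> //.
    by move=> f Mf; rewrite dotDr dotZr rpredD ?dvdz_mulr ?Mx0.
  by rewrite dotDr dotZr pe mulr0 addr0.
exists x0; split=> //; apply: Fpos (ltW ht) => i.
have -> : F *m x0 = D *: xc.
  apply/colP => j; apply: (mulfI d0).
  by have /colP/(_ j) := Fy; rewrite yE -scalemxAr -scalerA !mxE.
by rewrite !mxE mulr_ge0 // ltW.
Qed.

End DualLattice.

(** * Rational cones *)

Notation "A ^R" := (map_mx (intr : int -> _) A) (at level 2, format "A ^R").

Section Cone.
Variables (R : realType) (m k : nat).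

Lemma cone0 (v : 'I_k -> 'rV[R]_m) : cone v 0.
Proof. by exists (fun=> 0); split=> //; rewrite big1 // => i _; rewrite scale0r. Qed.

Lemma coneD (v : 'I_k -> 'rV[R]_m) x y : cone v x -> cone v y -> cone v (x + y).
Proof.
move=> [a [a0 ->]] [b [b0 ->]]; exists (fun i => a i + b i); split.
  by move=> i; rewrite addr_ge0.
by rewrite -big_split; apply: eq_bigr => i _; rewrite scalerDl.
Qed.

Lemma coneZ (v : 'I_k -> 'rV[R]_m) c x : 0 <= c -> cone v x -> cone v (c *: x).
Proof.
move=> c0 [a [a0 ->]]; exists (fun i => c * a i); split.
  by move=> i; rewrite mulr_ge0.
by rewrite scaler_sumr; apply: eq_bigr => i _; rewrite scalerA.
Qed.

Lemma cone_gen (v : 'I_k -> 'rV[R]_m) i : cone v (v i).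
Proof.
exists (fun j => (j == i)%:R); split; first by move=> j; rewrite ler0n.
rewrite (bigD1 i) //= eqxx scale1r big1 ?addr0 // => j /negPf->.
by rewrite scale0r.
Qed.

Lemma cone_sum (v : 'I_k -> 'rV[R]_m) l (P : pred 'I_l) (c : 'I_l -> R)
    (w : 'I_l -> 'rV[R]_m) :
  (forall i, P i -> 0 <= c i) -> (forall i, P i -> cone v (w i)) ->
  cone v (\sum_(i | P i) c i *: w i).
Proof.
move=> c0 vw; apply: (big_ind (cone v)); [exact: cone0|exact: coneD|].
by move=> i Pi; apply: coneZ; [exact: c0|exact: vw].
Qed.

Lemma cone_rowP (A : 'M[R]_(k, m)) x :
  cone (fun i => row i A) x <-> exists lam : 'rV_k, (forall i, 0 <= lam 0 i) /\ x = lam *m A.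
Proof.
split=> [[lam [lam0 ->]]|[lam [lam0 ->]]].
  exists (\row_i lam i); split; first by move=> i; rewrite mxE.
  by rewrite mulmx_sum_row; apply: eq_bigr => i _; rewrite mxE.
by exists (lam 0); split=> //; rewrite mulmx_sum_row.
Qed.

End Cone.

(** * Extreme rays of a rational cone *)

Section ExtremeRays.
Variables (R : realType) (m k : nat) (C : set 'rV[R]_m) (v : 'I_k -> 'rV[R]_m).
Hypotheses (pC : pointed_cone C) (vC : extreme_rays C v).

(** Otherwise [v i] could be eliminated from every combination, against minimality. *)
Lemma extreme_ray_irredundant i (c : 'I_k -> R) :
  (forall j, 0 <= c j) -> v i <> \sum_(j | j != i) c j *: v j.
Proof.
move=> c0 vi; case: vC => CE /(_ [set~ i]%SET) h.
suff /h : C = subcone v [set~ i]%SET.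
  by move/setP/(_ i); rewrite !inE eqxx.
rewrite CE; apply/seteqP; split=> x.
  move=> [lam [lam0 ->]]; exists (fun j => lam j + lam i * c j); split.
    by move=> j; rewrite addr_ge0 // mulr_ge0.
  rewrite (bigD1 i) //= [X in _ *: X]vi addrC scaler_sumr -big_split /=.
  apply: eq_big => [j|j _]; first by rewrite !inE.
  by rewrite scalerA scalerDl.
move=> [lam [lam0 ->]]; apply: cone_sum => // j _; exact: cone_gen.
Qed.

(* Substituting the two families of generators into one another writes v_i as
   a nonnegative combination of the v_l; as C contains no line, this
   combination is trivial, so some w_j occurring in v_i lies on the ray of v_i. *)
Lemma extreme_ray_generator l (w : 'I_l -> 'rV[R]_m) : C = cone w ->
  forall i, exists j c, 0 < c /\ w j = c *: v i.
Proof.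
move=> Cw i; have [Cv _] := vC.
have /choice[nu hnu] j : exists lam : 'I_k -> R,
    (forall i, 0 <= lam i) /\ w j = \sum_(i < k) lam i *: v i.
  by have := cone_gen w j; rewrite -Cw Cv.
have : cone w (v i) by rewrite -Cw Cv; exact: cone_gen.
move=> [mu [mu0 vi]].
pose r t := \sum_j mu j * nu j t.
have nu0 j t : 0 <= nu j t by case: (hnu j).
have r0 t : 0 <= r t by apply: sumr_ge0 => j _; rewrite mulr_ge0.
have vr : v i = \sum_t r t *: v t.
  rewrite {1}vi.
  under eq_bigr => j _ do rewrite (hnu j).2 scaler_sumr.
  rewrite exchange_big /=; apply: eq_bigr => t _.
  by rewrite scaler_suml; apply: eq_bigr => j _; rewrite scalerA.
(* If [r i < 1], solving [vr] for [v i] expresses it by the other generators. *)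
have ri : 1 <= r i.
  rewrite leNgt; apply/negP => ri.
  apply: (@extreme_ray_irredundant i (fun t => (1 - r i)^-1 * r t)).
    by move=> t; rewrite mulr_ge0 // invr_ge0 subr_ge0 ltW.
  under eq_bigr => t _ do rewrite -scalerA.
  rewrite -scaler_sumr.
  apply: (@scalerI _ _ (1 - r i)); first by rewrite subr_eq0 gt_eqF.
  rewrite scalerA divff ?subr_eq0 ?gt_eqF // scale1r scalerBl scale1r.
  by rewrite {1}vr (bigD1 i) //= addrAC subrr add0r.
(* If [r t] is nonzero, [vr] and [1 <= r i] put the opposite of [v t] into [C] as well, hence a
   whole line. *)
have rl t : t != i -> r t = 0.
  move=> ti; apply: contra_notP pC => /eqP rt.
  have vt : v t != 0.
    apply/eqP => vt0; apply: (@extreme_ray_irredundant t (fun=> 0)) => //.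
    by rewrite vt0 big1 // => ? _; rewrite scale0r.
  exists 0, (r t *: v t); split; first by rewrite scaler_eq0 (negPf rt).
  move=> s; rewrite add0r Cv; have [s0|s0] := leP 0 s.
    by do 2! apply: coneZ => //; exact: cone_gen.
  rewrite -[s]opprK scaleNr -scalerN; apply: coneZ; first by rewrite oppr_ge0 ltW.
  have -> : - (r t *: v t) = (r i - 1) *: v i +
      \sum_(t' | (t' != i) && (t' != t)) r t' *: v t'.
    move: vr; rewrite (bigD1 i) //= (bigD1 t) //= => vr.
    by rewrite scalerBl scale1r [X in _ - X]vr opprD addrA subrr sub0r opprD subrK.
  apply: coneD; first by apply: coneZ; [rewrite subr_ge0|exact: cone_gen].
  by apply: cone_sum => // ? _; exact: cone_gen.
have [j hj] : exists j, mu j * nu j i != 0.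
  apply/existsP; rewrite -negb_forall; apply/negP => /forallP h.
  move: ri; rewrite /r big1 ?ler10 // => j _; exact/eqP.
have [muj nuj] : mu j != 0 /\ nu j i != 0.
  by apply/andP; rewrite -negb_or -mulf_eq0.
exists j, (nu j i); split; first by rewrite lt_def nuj nu0.
rewrite (hnu j).2 (bigD1 i) //= big1 ?addr0 // => t /rl rt.
have /eqP : mu j * nu j t = 0.
  by apply: (psumr_eq0P _ rt) => // j' _; rewrite mulr_ge0.
by rewrite mulf_eq0 (negPf muj) => /eqP->; rewrite scale0r.
Qed.

End ExtremeRays.

Lemma integer_pointsP (R : realType) m (x : 'rV[R]_m) :
  integer_points x <-> exists y : 'rV[int]_m, x = y^R.
Proof.
split=> [/mxOverP h|[y ->]]; last first.
  by apply/mxOverP => i j; rewrite mxE; exact: intr_int.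
exists (map_mx Num.floor x); apply/matrixP => i j; rewrite !mxE.
by apply/esym/eqP; rewrite -intrEfloor.
Qed.

(** Extreme rays may be real vectors; each is rescaled to one of the integer generators. *)
Lemma extreme_rays_integer (R : realType) m k (C : set 'rV[R]_m)
    (v : 'I_k -> 'rV[R]_m) :
  rational_polyhedral_cone C -> extreme_rays C v ->
  exists W : 'M[int]_(k, m), C = cone (fun i => row i W^R).
Proof.
move=> [pC [l [w [wZ Cw]]]] vC.
have /choice[f hf] := extreme_ray_generator pC vC Cw.
have /choice[y wy] j : exists y : 'rV[int]_m, w j = y^R by apply/integer_pointsP.
exists (\matrix_i y (f i)).
have rowW i : row i (\matrix_i y (f i))^R = w (f i).
  by rewrite -map_row rowK wy.
apply/seteqP; split=> x.
  rewrite vC.1 => -[lam [lam0 ->]]; apply: cone_sum => // i _.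
  have [c [c0 wc]] := hf i.
  have -> : v i = c^-1 *: row i (\matrix_i y (f i))^R.
    by rewrite rowW wc scalerA mulVf ?scale1r // gt_eqF.
  by apply: coneZ; [rewrite invr_ge0 ltW|exact: (cone_gen (fun i => row i _))].
move=> [lam [lam0 ->]]; rewrite Cw; apply: cone_sum => // i _.
by rewrite rowW; exact: cone_gen.
Qed.

(** * Integral coordinates on rational cones *)

(** Induction on the support: while the generators in use are dependent, subtracting a multiple of a
    relation [c] removes at least one of them. *)
Lemma caratheodory (R : realFieldType) k m (A : 'M[R]_(k, m)) (lam : 'rV[R]_k) :
  (forall i, 0 <= lam 0 i) ->
  exists mu : 'rV[R]_k, [/\ forall i, 0 <= mu 0 i, mu *m A = lam *m A
    & forall c : 'rV[R]_k, (forall i, mu 0 i = 0 -> c 0 i = 0) ->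
        c *m A = 0 -> c = 0].
Proof.
have [N] := ubnP #|[set i | lam 0 i != 0]|; elim: N lam => // N IH lam.
rewrite ltnS => leN lam0.
have [h|] := pselect (forall c : 'rV[R]_k,
  (forall i, lam 0 i = 0 -> c 0 i = 0) -> c *m A = 0 -> c = 0).
  by exists lam.
move=> /existsNP[c /not_implyP[c0 /not_implyP[cA /eqP c_neq0]]].
wlog [i0 ci0] : c c0 cA c_neq0 / exists i, 0 < c 0 i.
  move=> wl; have /rV0Pn[i ci] := c_neq0.
  have [ci0|ci0] := ltP 0 (c 0 i); first by apply: (wl c) => //; exists i.
  apply: (wl (- c)); rewrite ?oppr_eq0 ?mulNmx ?cA ?oppr0 //.
    by move=> j /c0; rewrite mxE => ->; rewrite oppr0.
  by exists i; rewrite mxE oppr_gt0 lt_neqAle ci.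
(* The least ratio keeps all coefficients nonnegative and cancels the one at [j]. *)
pose j := [arg min_(i < i0 | 0 < c 0 i) (lam 0 i / c 0 i)]%O.
have [cj jmin] : 0 < c 0 j /\ forall i, 0 < c 0 i -> lam 0 j / c 0 j <= lam 0 i / c 0 i.
  by rewrite /j; case: arg_minP.
set tau := lam 0 j / c 0 j in jmin.
have tau0 : 0 <= tau by rewrite divr_ge0 // ltW.
have [||mu [mu0 muA indep]] := IH (lam - tau *: c).
- apply: leq_trans leN; apply: proper_card; apply/properP; split.
    apply/fintype.subsetP => i; rewrite !inE; apply: contraNN => /eqP li.
    by rewrite !mxE (c0 _ li) li mulr0 subr0.
  exists j; rewrite !inE; first by apply: contraTN cj => /eqP/c0->; rewrite ltxx.
  by rewrite !mxE divfK ?subrr ?eqxx // gt_eqF.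
- move=> i; rewrite !mxE subr_ge0; have [ci|ci] := ltP 0 (c 0 i).
    by rewrite -ler_pdivlMr // jmin.
  by apply: le_trans (lam0 i); rewrite mulr_ge0_le0.
exists mu; split=> //.
by rewrite muA mulmxBl -scalemxAl cA scaler0 subr0.
Qed.

Lemma common_denominator k m (Q : 'M[rat]_(k, m)) :
  exists (D : int) (Z : 'M[int]_(k, m)), 0 < D /\ D%:~R *: Q = Z^R.
Proof.
pose D := \prod_i \prod_j denq (Q i j).
have DQ i j : (denq (Q i j) %| D)%Z.
  by rewrite /D (bigD1 i) //= (bigD1 j) //= -mulrA dvdz_mulr.
exists D, (\matrix_(i, j) ((D %/ denq (Q i j))%Z * numq (Q i j))); split.
  by do 2! apply: prodr_gt0 => ? _.
apply/matrixP => i j; rewrite !mxE.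
rewrite -{1}(divzK (DQ i j)) !intrM -mulrA; congr (_ * _).
by rewrite -{2}[Q i j]divq_num_den mulrC divfK // intr_eq0 denq_neq0.
Qed.

Lemma intr_mx_inj (R : numDomainType) k m :
  injective (map_mx (intr : int -> R) : 'M_(k, m) -> _).
Proof.
move=> A B /matrixP AB; apply/matrixP => i j.
by have := AB i j; rewrite !mxE => /intr_inj.
Qed.

(* By Caratheodory a point of the cone has nonnegative coordinates on linearly
   independent generators; these are its image under a rational pseudoinverse,
   and there are only finitely many subsets of generators. *)
Lemma lattice_points_denominator (R : realType) k m (W : 'M[int]_(k, m)) :
  exists D : int, 0 < D /\ forall x : 'rV[int]_m,
    @cone R _ _ (fun i => row i W^R) x^R ->
    exists z : 'rV[int]_k, (forall i, 0 <= z 0 i) /\ D *: x = z *m W.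
Proof.
(* [WA A] blanks the rows outside [A]; [DD] runs over all [A] because the support depends on the
   point. *)
pose WA (A : {set 'I_k}) : 'M[int]_(k, m) := \matrix_(i, j) (W i j *+ (i \in A)).
have /choice[D /choice[Z DZ]] (A : {set 'I_k}) :
    exists (D : int) (Z : 'M[int]_(m, k)),
      0 < D /\ D%:~R *: pinvmx (WA A)^R = Z^R := common_denominator _.
pose D' (A : {set 'I_k}) := \prod_(B | B != A) D B.
pose DD := \prod_A D A.
have DE A : DD = D' A * D A by rewrite /DD (bigD1 A) //= mulrC.
have DD0 : 0 < DD by apply: prodr_gt0 => A _; case: (DZ A).
exists DD; split=> // x /cone_rowP[lam [lam0 xE]].
have [mu [mu0 muW indep]] := caratheodory W^R lam0.
pose A := [set i | mu 0 i != 0]%SET.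
have muA (nu : 'rV[R]_k) : nu *m (WA A)^R = (\row_i (nu 0 i *+ (i \in A))) *m W^R.
  apply/rowP => j; rewrite !mxE; apply: eq_bigr => i _; rewrite !mxE.
  by case: (i \in A); rewrite ?mulr1n // !mulr0n mul0r mulr0.
have muE : mu *m (WA A)^R = x^R.
  rewrite muA xE -muW; congr (_ *m _); apply/rowP => i; rewrite mxE inE.
  by case: eqP => //= ->.
pose nu : 'rV[R]_k := x^R *m pinvmx (WA A)^R.
have nuE : nu *m (WA A)^R = x^R.
  by rewrite mulmxKpV // -muE submxMl.
have nu_mu i : i \in A -> nu 0 i = mu 0 i.
  move=> iA; have := indep (\row_i ((nu 0 i - mu 0 i) *+ (i \in A))).
  have -> : \row_i ((nu 0 i - mu 0 i) *+ (i \in A)) =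
      \row_i ((nu - mu) 0 i *+ (i \in A)) by apply/rowP => l; rewrite !mxE.
  rewrite -muA mulmxBl nuE muE subrr => /(_ _ erefl) h.
  have /rowP/(_ i) : \row_i ((nu - mu) 0 i *+ (i \in A)) = 0.
    by apply: h => l ml; rewrite mxE inE ml eqxx.
  by rewrite !mxE iA mulr1n => /eqP; rewrite subr_eq0 => /eqP.
have DnuE : DD%:~R *: nu = (D' A *: (x *m Z A))^R.
  have [_ /(congr1 (map_mx (ratr : rat -> R)))] := DZ A.
  rewrite map_mxZ map_pinvmx /= ratr_int -!map_mx_comp.
  have rI n p (B : 'M[int]_(n, p)) : map_mx (ratr \o intr) B = B^R :> 'M[R]_(n, p).
    by apply: eq_map_mx => q /=; rewrite ratr_int.
  rewrite !rI => DZR.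
  rewrite map_mxZ map_mxM -DZR -scalemxAr scalerA -intrM -DE.
  by [].
(* [nu] is known to agree with [mu] only on [A]; elsewhere [mu] is zero, and so is [z]. *)
pose z : 'rV[int]_k := \row_i ((D' A *: (x *m Z A)) 0 i *+ (i \in A)).
have zE : z^R = DD%:~R *: mu.
  apply/rowP => i; rewrite [LHS]mxE [z 0 i]mxE [RHS]mxE.
  have [iA|] := boolP (i \in A).
    by have /rowP/(_ i) := DnuE; rewrite -nu_mu // [LHS]mxE [RHS]mxE => ->.
  by rewrite inE negbK => /eqP->; rewrite mulr0.
exists z; split.
  move=> i; move/rowP/(_ i): zE; rewrite !mxE => zi.
  by rewrite -(ler0z R) zi mulr_ge0 // ler0z ltW.
by apply: (@intr_mx_inj R); rewrite map_mxM zE -scalemxAl muW -xE map_mxZ.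
Qed.

(** [Q] projects onto the saturation of the row lattice of [W]: in Smith form it is the coordinate
    projection [K] onto the nonzero invariant factors, conjugated by the unimodular [T]. *)
Lemma integral_projection (R : numFieldType) k m (W : 'M[int]_(k, m)) :
  exists (Q : 'M[int]_m) (G : 'M[R]_(m, k)), W *m Q = W /\ Q^R = G *m W^R.
Proof.
have [L Lu [T Tu [d _ WE]]] := int_Smith_normal_form W.
set E := (X in L *m X *m T) in WE.
(* Entries past the end of [d] read as 0. *)
pose r (j : 'I_m) : int := [exists i : 'I_k, (i == j :> nat) && (d`_i != 0)]%:Z.
pose K : 'M[int]_m := diag_mx (\row_j r j).
have EK : E *m K = E.
  apply/matrixP => i j; rewrite mul_mx_diag !mxE /r.
  have [ij|_] := eqVneq (i : nat) j; last by rewrite mulr0n mul0r.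
  case: existsP => [_|h]; first by rewrite mulr1.
  rewrite mulr1n mulr0; case: (eqVneq d`_i 0) => [->//|di].
  by case: h; exists i; rewrite di ij eqxx.
pose G : 'M[R]_(m, k) := \matrix_(j, i) ((d`_i)%:~R^-1 *+ (i == j :> nat)).
have GE : K^R = G *m E^R.
  apply/matrixP => j l; rewrite !mxE /r.
  case: existsP => [[i /andP[/eqP ij di]]|h].
    rewrite (bigD1 i) //= !mxE ij eqxx mulr1n big1 ?addr0 => [|i' ii']; last first.
      rewrite !mxE -ij (_ : (i' == i :> nat) = false) ?mulr0n ?mul0r //.
      by apply/negbTE; rewrite val_eqE.
    rewrite -ij (_ : (j == l) = (j == l :> nat)) // -ij.
    case: eqP => _; last by rewrite !mulr0n mulr0.
    by rewrite !mulr1n mulVf // intr_eq0.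
  rewrite mul0rn rmorph0 big1 // => i _; rewrite !mxE.
  have [ij|_] := eqVneq (i : nat) j; last by rewrite mulr0n mul0r.
  have -> : d`_i = 0.
    by apply/eqP/negPn/negP => di; apply: h; exists i; rewrite di ij eqxx.
  by rewrite mul0rn mulr0.
exists (invmx T *m K *m T), ((invmx T)^R *m G *m (invmx L)^R); split.
  rewrite WE -!mulmxA; congr (_ *m _); rewrite !mulmxA; congr (_ *m _).
  by rewrite mulmxK // EK.
rewrite WE !map_mxM GE -!mulmxA; congr (_ *m (_ *m _)).
by rewrite [RHS]mulmxA -[_ *m L^R]map_mxM mulVmx // map_mx1 mul1mx.
Qed.

(* Killing the saturation of the span of the generators on which c vanishes is
   harmless: adding these generators does not change the value of c. *)
Lemma positive_generators (R : realType) k m (W : 'M[int]_(k, m)) (c : 'cV[int]_m) :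
  (forall i, 0 <= (W *m c) i 0) -> W *m c != 0 ->
  exists W' : 'M[int]_(k, m), (forall i, 0 < (W' *m c) i 0) /\
    forall t : int,
      (exists x : 'rV[int]_m, @cone R _ _ (fun i => row i W^R) x^R /\ (x *m c) 0 0 = t) <->
      (exists x : 'rV[int]_m, @cone R _ _ (fun i => row i W'^R) x^R /\ (x *m c) 0 0 = t).
Proof.
move=> p_ge0 /cV0Pn[j0 pj0].
have [p pE] : {p | p = W *m c} by exists (W *m c).
rewrite -pE in p_ge0 pj0.
have pj0_gt0 : 0 < p j0 0 by rewrite lt_def pj0 p_ge0.
(* [Z] selects the generators of value 0 and [I0] the others; [T] replaces the former by copies of
   generator [j0], which keeps their number equal to [k]. *)
pose Z : 'M[int]_k := diag_mx (\row_i (p i 0 == 0)%:Z).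
pose T : 'M[int]_k := \matrix_i delta_mx 0 (if p i 0 == 0 then j0 else i).
pose I0 : 'M[int]_k := diag_mx (\row_i (p i 0 != 0)%:Z).
have ZI : 1%:M = Z + I0.
  apply/matrixP => i j; rewrite !mxE -mulrnDl.
  by case: (eqVneq (p i 0) 0) => _; rewrite ?addr0 ?add0r.
have [Q [G [WQ QG]]] := integral_projection R (Z *m W).
have Zc : Z *m W *m c = 0.
  apply/colP => i; rewrite -mulmxA -pE mul_diag_mx !mxE.
  by have [->|_] := eqVneq (p i 0) 0; rewrite ?mulr0 ?mul0r.
have Qc : Q *m c = 0.
  apply: (@intr_mx_inj R); rewrite map_mxM QG -mulmxA -map_mxM Zc.
  by rewrite !map_mx0 mulmx0.
(* [E] kills the generators of value 0 and preserves the values of [c]. *)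
pose E := 1%:M - Q.
have Ec : E *m c = c by rewrite mulmxBl mul1mx Qc subr0.
have ZE : Z *m W *m E = 0 by rewrite mulmxBr mulmx1 WQ subrr.
have WE : W *m E = I0 *m W *m E.
  by rewrite -[W in LHS]mul1mx ZI !mulmxDl ZE add0r.
have I0T : I0 *m T = I0.
  apply/matrixP => i j; rewrite mul_diag_mx !mxE.
  by case: eqP => _; rewrite ?mul0r ?mul0rn //= mul1r eq_sym.
exists (T *m W *m E); split.
  move=> i; rewrite -mulmxA Ec -mulmxA -pE -dot_row rowK dot_delta.
  by case: eqP => // /eqP pi; rewrite lt_def pi p_ge0.
have Mge0 (A : 'M[int]_k) : (forall i j, 0 <= A i j) -> forall lam : 'rV[R]_k,
    (forall i, 0 <= lam 0 i) -> forall i, 0 <= (lam *m A^R) 0 i.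
  move=> A0 lam lam0 i; rewrite mxE; apply: sumr_ge0 => j _.
  by rewrite mxE mulr_ge0 // ler0z.
have I0_ge0 i j : 0 <= I0 i j by rewrite !mxE; case: (p i 0 != 0); case: (i == j).
have Z_ge0 i j : 0 <= Z i j by rewrite !mxE; case: (p i 0 == 0); case: (i == j).
have T_ge0 i j : 0 <= T i j by rewrite !mxE; case: (_ && _).
move=> t; split=> -[x [/cone_rowP[lam [lam0 xE]] xt]].
  exists (x *m E); split; last by rewrite -mulmxA Ec.
  apply/cone_rowP; exists (lam *m I0^R); split; first exact: Mge0.
  by rewrite map_mxM xE -!mulmxA -!map_mxM !mulmxA I0T -WE.
pose mu := lam *m T^R.
pose s := mu *m W^R *m G.
(* [N] dominates the coefficients [s] subtracted by the projection; adding [N] times each generator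
   of value 0 restores nonnegativity at no cost in value. *)
pose N : int := \sum_i `|Num.ceil (s 0 i)|.
have sN i : s 0 i <= N%:~R.
  apply: le_trans (ceil_ge _) _; rewrite ler_int.
  apply: le_trans (ler_norm _) _; rewrite /N (bigD1 i) //= lerDl.
  exact: sumr_ge0.
pose y : 'rV[int]_k := const_mx N.
exists (x + y *m (Z *m W)); split; last first.
  by rewrite mulmxDl -[y *m _ *m _]mulmxA Zc mulmx0 addr0.
have -> : (x + y *m (Z *m W))^R = mu *m W^R + (y^R - s) *m Z^R *m W^R.
  rewrite map_mxD xE !map_mxM map_mxB map_mx1 QG !map_mxM /s /mu.
  rewrite !(mulmxBr, mulmxBl) !mulmxA mulmx1.
  by rewrite -addrA [- _ + _]addrC.
apply: coneD; apply/cone_rowP.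
  by exists mu; split=> //; exact: Mge0.
exists ((y^R - s) *m Z^R); split=> //; apply: Mge0 => // i.
rewrite [leRHS]mxE [X in X + _]mxE [X in _ + X]mxE [y 0 i]mxE subr_ge0.
exact: sN.
Qed.

Section Pairing.
Variables (R : realType) (m : nat) (c : 'cV[R]_m).

Definition pairing (x : 'rV[R]_m) : R := (x *m c) 0 0.

Lemma pairing_is_scalar : scalar pairing.
Proof. by move=> a x y; rewrite /pairing mulmxDl -scalemxAl !mxE. Qed.

HB.instance Definition _ :=
  GRing.isLinear.Build R 'rV[R]_m R *%R pairing pairing_is_scalar.

End Pairing.

Lemma scalar_intE (R : realType) m (pi : {scalar 'rV[R]_m}) :
  integer_coefficients pi ->
  exists c : 'cV[int]_m, forall x : 'rV[int]_m, pi x^R = ((x *m c) 0 0)%:~R.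
Proof.
move=> piZ; exists (\col_j Num.floor (pi (delta_mx 0 j))) => x.
rewrite {1}[x^R]row_sum_delta linear_sum mxE rmorph_sum /=; apply: eq_bigr => j _.
rewrite linearZ !mxE rmorphM /=; congr (_ * _).
by apply/esym/eqP; rewrite -intrEfloor.
Qed.

(** * From cones to quotients *)

(** Take [M] spanned by the columns of [W'] and [D] times all forms. Then [z] is in the dual lattice
    exactly when [D] divides [z^T *m W'], and the quotients by [D], for [z] nonnegative, are the
    lattice points of the cone. *)
Lemma normalescent_quotient (R : realType) k (S : set nat) :
  S <> [set 0%N]%classic -> S 0%N ->
  k_ray_normalescent R k.+1 S -> is_k_quotient k.+1 S.
Proof.
move=> S_neq0 S0 [m [C [pi [ratC [v vC] piZ SE]]]].
have [W CW] := extreme_rays_integer ratC vC.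
have [c cE] := scalar_intE piZ.
have SP t : S t <-> exists x : 'rV[int]_m,
    @cone R _ _ (fun i => row i W^R) x^R /\ (x *m c) 0 0 = t%:Z.
  split=> [St|[x [Cx xt]]].
    have : ((fun n : nat => n%:R : R) @` S)%classic t%:R by exists t.
    rewrite SE => -[y [Cy /integer_pointsP[x yx]] yt].
    exists x; rewrite -yx -CW; split=> //.
    by apply: (@intr_inj R); rewrite -cE -yx yt.
  have : (pi @` (C `&` @integer_points R m))%classic (pi x^R).
    by exists x^R => //; split; [rewrite CW|apply/integer_pointsP; exists x].
  rewrite -SE cE xt => -[n Sn /eqP].
  by rewrite -[_%:~R]/(t%:R) eqr_nat => /eqP <-.
have p_ge0 i : 0 <= (W *m c) i 0.
  have : (pi @` (C `&` @integer_points R m))%classic (pi (row i W)^R).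
    exists (row i W)^R => //; split; last by apply/integer_pointsP; exists (row i W).
    by rewrite CW map_row; exact: (cone_gen (fun i => row i _)).
  rewrite -SE cE -row_mul mxE => -[n _ nE].
  by rewrite -(ler0z R) -nE ler0n.
(* If all generators had value 0, [S] would contain only 0. *)
have p_neq0 : W *m c != 0.
  apply: contra_notN S_neq0 => /eqP Wc; apply/seteqP; split=> t; last by move=> ->.
  move=> /SP[x [/cone_rowP[lam [_ xE]] xt]] /=.
  have : (x *m c)^R = 0 :> 'M[R]_1.
    by rewrite map_mxM xE -mulmxA -map_mxM Wc map_mx0 mulmx0.
  by move/matrixP/(_ 0 0); rewrite [LHS]mxE [RHS]mxE xt => /eqP; rewrite intr_eq0 => /eqP[].
have [W' [p'_gt0 W'E]] := positive_generators R p_ge0 p_neq0.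
have [D [D_gt0 DE]] := lattice_points_denominator R W'.
pose M (f : 'rV[int]_k.+1) := exists (u : 'cV[int]_m) e, f = (W' *m u)^T + D *: e.
have MB f g : M f -> M g -> M (f - g).
  move=> [u [e ->]] [u' [e' ->]]; exists (u - u'), (e - e').
  by rewrite mulmxBr linearB /= scalerBr opprD addrACA.
have MD e : M (D *: e) by exists 0, e; rewrite mulmx0 trmx0 add0r.
have Mp : M (W' *m c)^T by exists c, 0; rewrite scaler0 addr0.
have [|d [a [d_gt0 a_gt0 aE]]] := dual_lattice_quotient MB MD D_gt0 Mp.
  by move=> j; rewrite mxE.
have dotT (u : 'cV[int]_m) (z : 'cV[int]_k.+1) :
    dot (W' *m u)^T z = (z^T *m W' *m u) 0 0.
  by rewrite /dot -[z in LHS]trmxK -trmx_mul mxE mulmxA.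
exists d, a; split=> //; apply/seteqP; split=> t.
  move=> /SP/W'E[x [/DE[z [z0 xz]] xt]]; apply/aE; exists z^T; split.
  - by move=> i; rewrite mxE.
  - move=> f [u [e ->]]; rewrite dotDl dotZl dotT trmxK -xz -scalemxAl mxE.
    by rewrite rpredD // dvdz_mulr.
  - by rewrite dotT trmxK -xz -scalemxAl mxE xt.
move=> /aE[z [z0 Mz pz]]; apply/SP/W'E.
pose x : 'rV[int]_m := \row_j ((z^T *m W') 0%R j %/ D)%Z.
have xz : D *: x = z^T *m W'.
  apply/rowP => j; rewrite [LHS]mxE [x 0 j]mxE mulrC divzK //.
  have Mj : M (W' *m delta_mx j 0)^T.
    by exists (delta_mx j 0), 0; rewrite scaler0 addr0.
  by have := Mz _ Mj; rewrite dotT -colE [X in (_ %| X)%Z -> _]mxE.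
have D0 : D%:~R != 0 :> R by rewrite intr_eq0 gt_eqF.
exists x; split.
  apply/cone_rowP; exists (D%:~R^-1 *: (z^T)^R); split.
    by move=> i; rewrite !mxE mulr_ge0 ?invr_ge0 ?ler0z // ltW.
  by rewrite -scalemxAl -map_mxM -xz map_mxZ scalerA mulVf // scale1r.
apply: (mulfI (lt0r_neq0 D_gt0)); by rewrite -pz dotT -xz -scalemxAl [RHS]mxE.
Qed.

(** * From quotients to cones *)

Section Forward.
Variables (R : realType) (k d : nat) (a : 'I_k -> nat).
Hypothesis d_gt0 : (0 < d)%N.

(* Its lattice points are the (x, t) with x in N^k and a . x = d t. *)
Definition graph_ray (i : 'I_k) : 'rV[R]_(k + 1) :=
  row_mx (d%:R *: delta_mx 0 i) (a i)%:R%:M.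

Let d_neq0 : d%:R != 0 :> R. Proof. by rewrite pnatr_eq0 -lt0n. Qed.

Lemma graph_ray_sum (P : pred 'I_k) (lam : 'I_k -> R) :
  \sum_(i | P i) lam i *: graph_ray i =
  row_mx (\row_i (if P i then lam i * d%:R else 0))
    (\sum_(i | P i) lam i * (a i)%:R)%:M.
Proof.
apply/rowP => j; rewrite summxE -[j]splitK; case: (split j) => i /=.
  rewrite row_mxEl mxE; under eq_bigr => l _ do rewrite mxE row_mxEl !mxE eqxx.
  case: ifP => Pi; last first.
    apply: big1 => l Pl; case: eqP => [il|_]; last by rewrite !mulr0.
    by rewrite il Pl in Pi.
  rewrite (bigD1 i) //= eqxx mulr1 big1 ?addr0 // => l /andP[_ li].
  by rewrite eq_sym (negPf li) !mulr0.
rewrite row_mxEr mxE ord1 eqxx mulr1n; apply: eq_bigr => l _.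
by rewrite mxE row_mxEr mxE eqxx mulr1n.
Qed.

Lemma graph_coneP x y : cone graph_ray (row_mx x y) <->
  (forall i, 0 <= x 0 i) /\ d%:R * y 0 0 = \sum_i (a i)%:R * x 0 i.
Proof.
split.
  move=> [lam [lam0]]; rewrite graph_ray_sum => /eq_row_mx[-> ->].
  split=> [i|]; first by rewrite mxE mulr_ge0.
  rewrite mxE eqxx mulr1n mulr_sumr; apply: eq_bigr => i _; rewrite mxE; ring.
move=> [x0 dy]; exists (fun i => x 0 i / d%:R); split.
  by move=> i; rewrite divr_ge0.
rewrite graph_ray_sum; congr row_mx.
  by apply/rowP => i; rewrite mxE divfK.
apply/matrixP => i j; rewrite !ord1 mxE eqxx mulr1n; apply: (mulfI d_neq0).
rewrite dy mulr_sumr; apply: eq_bigr => l _.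
by rewrite [RHS]mulrA [d%:R * _]mulrC divfK // mulrC.
Qed.

(** Along a line in the cone the first [k] coordinates stay nonnegative, hence constant, and they
    determine the last one since [d] is nonzero. *)
Lemma graph_cone_rational : rational_polyhedral_cone (cone graph_ray).
Proof.
split; last first.
  exists k, graph_ray; split=> // i; apply/integer_pointsP.
  exists (row_mx (d%:Z *: delta_mx 0 i) (a i)%:Z%:M).
  by rewrite map_row_mx map_mxZ map_delta_mx map_scalar_mx.
move=> [p [u [u0]]]; rewrite -[p]hsubmxK -[u]hsubmxK => h.
have {}h t : (forall i, 0 <= (lsubmx p) 0 i + t * (lsubmx u) 0 i) /\
    d%:R * ((rsubmx p) 0 0 + t * (rsubmx u) 0 0) =
    \sum_i (a i)%:R * ((lsubmx p) 0 i + t * (lsubmx u) 0 i).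
  have := h t; rewrite scale_row_mx add_row_mx => /graph_coneP[h1 h2].
  split=> [i|]; first by have := h1 i; rewrite !mxE.
  move: h2; rewrite !mxE => ->; apply: eq_bigr => i _; by rewrite !mxE.
have ul i : (lsubmx u) 0 i = 0.
  apply/eqP/negPn/negP => ui.
  (* At this parameter the coordinate would be -1. *)
  have := (h (- ((lsubmx p) 0 i + 1) / (lsubmx u) 0 i)).1 i.
  by rewrite divfK // opprD addrA subrr sub0r oppr_ge0 ler10.
have sum_eq t : \sum_i (a i)%:R * ((lsubmx p) 0 i + t * (lsubmx u) 0 i) =
    \sum_i (a i)%:R * (lsubmx p) 0 i.
  by apply: eq_bigr => i _; rewrite ul mulr0 addr0.
have ur : (rsubmx u) 0 0 = 0.
  have := (h 1).2; have := (h 0).2; rewrite !sum_eq => <- /(mulfI d_neq0).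
  by move=> /addrI; rewrite mul0r mul1r.
move/eqP: u0; apply; rewrite -[u]hsubmxK -row_mx0; congr row_mx.
  by apply/rowP => i; rewrite ul mxE.
by apply/rowP => i; rewrite !ord1 ur mxE.
Qed.

(** Only the [i]-th ray has a nonzero [i]-th coordinate, so none can be omitted. *)
Lemma graph_cone_rays : extreme_rays (cone graph_ray) graph_ray.
Proof.
split=> // A CA; apply/setP => i; rewrite inE; apply/negPn/negP => iA.
have := cone_gen graph_ray i; rewrite CA => -[lam [_]].
rewrite graph_ray_sum => /eq_row_mx[/rowP/(_ i)].
by rewrite !mxE !eqxx (negPf iA) mulr1 => /eqP; rewrite (negPf d_neq0).
Qed.

End Forward.

Lemma quotient_normalescent (R : realType) k (S : set nat) :
  is_k_quotient k S -> k_ray_normalescent R k S.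
Proof.
move=> [d [a [d_gt0 _ ->]]].
have d_neq0 : d%:R != 0 :> R by rewrite pnatr_eq0 -lt0n.
pose pi : {scalar 'rV[R]_(k + 1)} := pairing (delta_mx (rshift k 0) 0).
have piE x y : pi (row_mx x y) = y 0 0.
  by rewrite /= /pairing -colE mxE row_mxEr.
exists (k + 1)%N, (cone (graph_ray R d a)), pi; split.
- exact: graph_cone_rational.
- exists (graph_ray R d a); exact: graph_cone_rays.
- by move=> j; rewrite /= /pairing -colE !mxE; case: (_ && _).
apply/seteqP; split=> r.
  move=> [t [x tx] <-].
  exists (row_mx (\row_i (x i)%:R) t%:R%:M); last by rewrite piE mxE eqxx mulr1n.
  split; last first.
    apply/integer_pointsP; exists (row_mx (\row_i (x i)%:Z) t%:Z%:M).
    rewrite map_row_mx map_scalar_mx; congr row_mx.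
    by apply/rowP => i; rewrite !mxE.
  apply/(graph_coneP a d_gt0); split=> [i|]; first by rewrite mxE.
  rewrite mxE eqxx mulr1n -natrM tx natr_sum; apply: eq_bigr => i _.
  by rewrite mxE natrM.
move=> [z [Cz /integer_pointsP[w zw]] <-].
move: Cz; rewrite zw -[w]hsubmxK map_row_mx.
set x := lsubmx w; set y := rsubmx w => /(graph_coneP a d_gt0)[x0 dy].
rewrite piE mxE.
have {}x0 i : 0 <= x 0 i by have := x0 i; rewrite mxE ler0z.
have {}dy : d%:Z * y 0 0 = (\sum_(i < k) a i * `|x 0%R i|)%N%:Z.
  apply: (@intr_inj R); rewrite intrM.
  move: dy; rewrite [y^R _ _]mxE => ->.
  rewrite -[RHS]/((\sum_(i < k) a i * `|x 0%R i|)%N%:R) natr_sum.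
  apply: eq_bigr => i _; rewrite mxE natrM; congr (_ * _).
  by rewrite -[x 0 i]gez0_abs.
have y0 : 0 <= y 0 0 by rewrite -(pmulr_rge0 _ (_ : 0 < d%:Z)) ?dy.
exists `|y 0%R 0%R|%N.
  exists (fun i => `|x 0%R i|%N); apply/eqP; rewrite -eqz_nat PoszM gez0_abs //.
  by rewrite dy.
by rewrite -[in RHS](gez0_abs y0).
Qed.

Theorem theorem1p5 (R : realType) (k : nat) (hk : (0 < k)%N) (S : set nat)
    (hS : numerical_semigroup S) (hS0 : S <> [set 0%N]%classic) :
  is_k_quotient k S <-> k_ray_normalescent R k S.
Proof.
split; first exact: quotient_normalescent.
by case: k hk => // k _; apply: normalescent_quotient => //; case: hS.
Qed.
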